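(* Let $X$ be a real Banach space. Then the following assertions are equivalent. (1) $X$ contains no isomorphic copy of $\ell_1$ (i.e. no subspace of $X$ is linearly homeomorphic to $\ell_1$). (2) Each bounded separable subset of $X$ is Fréchet-Urysohn in the weak topology. (3) For each separable subset $A\subset X$ there are relatively weakly closed subsets $A_n$, $n\in\mathbb{N}$, of $A$ such that $A=\bigcup_{n\in\mathbb{N}}A_n$ and each $A_n$ is Fréchet-Urysohn in the weak topology.
   Context: A topological space $T$ is called Fréchet-Urysohn if whenever $A\subset T$ and $x\in T$ is such that $x\in\overline{A}$, there is a sequence $\{x_n\}$ in $A$ with $x_n\to x$. A subset of $X$ is said to be Fréchet-Urysohn in the weak topology if it is a Fréchet-Urysohn space when equipped with the subspace topology inherited from the weak topology of $X$. A subset of $A$ is relatively weakly closed if it is closed in $A$ for the topology on $A$ inherited from the weak topology of $X$. ''Separable'' and ''bounded'' refer to the norm (for subsets of $X$, norm separability coincides with weak separability). *)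

(* Defs.v *)
From HB Require Import structures.
From mathcomp Require Import all_boot all_order all_algebra.
From mathcomp Require Import all_classical all_reals all_analysis.

Set Implicit Arguments.
Unset Strict Implicit.
Unset Printing Implicit Defensive.

Import Order.TTheory GRing.Theory Num.Theory.
Import numFieldNormedType.Exports.

Local Open Scope classical_set_scope.
Local Open Scope ring_scope.

(** * The space l_1 of absolutely summable real sequences

    The norm instance makes [`|u|] convertible to [ell1_norm u]. *)

Section ell1.
Context {R : realType}.

Definition ell1_pred : {pred nat -> R^o} :=
  fun u => `[< cvgn [normed series u] >].

Lemma ell1_predP (u : nat -> R^o) :
  reflect (cvgn [normed series u]) (u \in ell1_pred).
Proof. exact: asboolP. Qed.

Lemma ell1_submod_closed : submod_closed ell1_pred.
Proof.
split.
  apply/ell1_predP.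
  have -> : [normed series (0 : nat -> R^o)] = fun=> 0.
    by apply/funext => n; apply: big1 => i _; exact: normr0.
  exact: is_cvg_cst.
move=> a u v /ell1_predP cu /ell1_predP cv; apply/ell1_predP.
have cs : cvgn (series (`|a| *: (fun n => `|u n|) + (fun n => `|v n|) : R^nat)).
  by apply: is_cvg_seriesD => //; exact: is_cvg_seriesZ.
apply: series_le_cvg cs => n //=.
  by rewrite addr_ge0// mulr_ge0.
by rewrite (le_trans (ler_normD _ _))// normrZ.
Qed.

HB.instance Definition _ := GRing.isSubmodClosed.Build R (nat -> R^o)
  ell1_pred ell1_submod_closed.

Record ell1 := Ell1 { ell1_seq :> nat -> R^o ; _ : ell1_seq \in ell1_pred }.

HB.instance Definition _ := [isSub for ell1_seq].
HB.instance Definition _ := [Choice of ell1 by <:].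
HB.instance Definition _ := [SubChoice_isSubLmodule of ell1 by <:].

Lemma is_cvg_ell1 (u : ell1) : cvgn [normed series u].
Proof. exact/ell1_predP/(valP u). Qed.

Definition ell1_norm (u : ell1) : R := limn [normed series u].

Lemma ell1_normD (u v : ell1) : ell1_norm (u + v) <= ell1_norm u + ell1_norm v.
Proof.
rewrite /ell1_norm -lim_seriesD; [|exact: is_cvg_ell1..].
apply: lim_series_le.
- exact: is_cvg_ell1.
- by apply: is_cvg_seriesD; exact: is_cvg_ell1.
- by move=> n; exact: ler_normD.
Qed.

Lemma ell1_normZ (a : R) (u : ell1) : ell1_norm (a *: u) = `|a| * ell1_norm u.
Proof.
rewrite /ell1_norm -[RHS]lim_seriesZ; last exact: is_cvg_ell1.
congr (limn (series _)); apply/funext => n.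
exact: (@normrZ R R^o).
Qed.

Lemma ell1_norm0_eq0 (u : ell1) : ell1_norm u = 0 -> u = 0.
Proof.
move=> u0; apply: val_inj; apply/funext => n /=.
have ndu : nondecreasing_seq [normed series u].
  by apply: nondecreasing_series => k _ _; exact: normr_ge0.
have un0 : [normed series u] n.+1 <= 0.
  rewrite -u0; exact: (nondecreasing_cvgn_le ndu (@is_cvg_ell1 u) n.+1).
apply/eqP; rewrite -normr_le0; apply: le_trans un0.
rewrite /normed_series_of seriesSr lerDr; apply: sumr_ge0 => k _; exact: normr_ge0.
Qed.

HB.instance Definition _ := Lmodule_isNormed.Build R ell1
  ell1_normD ell1_normZ ell1_norm0_eq0.

End ell1.

Arguments ell1 : clear implicits.

(** * Isomorphic copies

    [{within V, continuous g}] only constrains the restriction of [g] to [V],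
    which is the inverse of [f]. *)

Definition linear_homeomorphism (R : realType) (Y X : normedModType R)
    (V : set X) (f : {linear Y -> X}) : Prop :=
  [/\ set_bij [set: Y] V f, continuous f &
      exists2 g : X -> Y, cancel f g & {within V, continuous g}].

Definition contains_isomorphic_copy (R : realType) (X Y : normedModType R) :=
  exists2 V : set X, submod_closed (mem V) &
    exists f : {linear Y -> X}, linear_homeomorphism V f.

(** * The weak topology

    The coarsest topology making all continuous linear functionals on [X]
    continuous; [R^o] is [R] seen as a normed space over itself. *)

Definition weak_family (R : realType) (X : normedModType R)
    (f : {f : {linear X -> R^o} | continuous f}) : Topological X :=
  Topological.class (initial_topology (projT1 f : X -> R^o)).

Definition weak (R : realType) (X : normedModType R) : Type :=
  sup_topology (@weak_family R X).

HB.instance Definition _ (R : realType) (X : normedModType R) :=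
  Topological.on (weak X).

(** * Topological notions

    Subsets are viewed as spaces through [set_type], which carries the topology
    induced by the ambient space.  The ambient type is given explicitly when it
    is [weak X], since [weak X] is convertible to [X]: [set_type A] alone has
    the norm topology. *)

Definition separable_space (T : topologicalType) : Prop :=
  exists2 D : set T, countable D & dense D.

Definition Frechet_Urysohn (T : topologicalType) : Prop :=
  forall (A : set T) (x : T), closure A x ->
    exists2 u : nat -> T, (forall n, A (u n)) & u n @[n --> \oo] --> x.

Definition separable_set (R : realType) (X : normedModType R) (A : set X) :=
  separable_space (set_type A).

Definition weakly_Frechet_Urysohn (R : realType) (X : normedModType R)
    (A : set X) : Prop :=
  Frechet_Urysohn (@set_type (weak X) A).

Definition relatively_weakly_closed (R : realType) (X : normedModType R)
    (A B : set X) : Prop :=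
  B `<=` A /\ closed [set a : @set_type (weak X) A | B (set_val a)].

(* Main.v *)
Require Import Defs.
From HB Require Import structures.
From mathcomp Require Import all_boot all_order all_algebra.
From mathcomp Require Import all_classical all_reals all_analysis.
From mathcomp Require Import ring lra zify.

Import Order.TTheory GRing.Theory Num.Theory.
Import numFieldNormedType.Exports.

Set Implicit Arguments.
Unset Strict Implicit.
Unset Printing Implicit Defensive.

Local Open Scope classical_set_scope.
Local Open Scope ring_scope.

(** If [X] contains l_1, then in every ball of a suitable separable set there is
    a point of a weak closure that no sequence reaches; conversely, at a point of
    the weak closure of a bounded set, a dichotomy produces either a weakly
    convergent sequence or a copy of l_1.

    If [X] contains a copy of l_1, the images [x n] of the unit vectors are
    bounded and every 0-1 sequence [S] extends to a continuous functional with
    [F (x n) = S n] ([copy_separated_sequence]).  For every bounded functional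
    the reals [f (x n)] converge along a free ultrafilter, so any point [a] lies
    in the weak closure of the points [a + s *: (x n - x m)] with [n < m]; yet
    no sequence of them tends weakly to [a], because for any pairs
    [n k < m k] some [S] separates [n k] from [m k] infinitely often
    ([separating_pairs]).  This pattern fits into every ball of the closed
    separable set [A] of limits of rational combinations of the [x n], and by
    the Baire category argument a countable cover of [A] by relatively weakly
    closed sets has a member containing such a ball ([not_decomposable]).

    Conversely, suppose that [X] is complete, [v] is a bounded family in [X]
    and [v t] tends weakly to 0 along an ultrafilter [U].  For [e > 0] consider
    a game on sets [C] of functionals in the dual ball: at each round player I
    names a set [A] in [U], player II picks [t] in [A], and [C] shrinks to its
    part where [e <= f (v t)].  Call [C] null if player I can force it to become
    empty after finitely many rounds.  Null sets form an ideal.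
    - If for each [e] the whole dual ball is null, player I follows all the
      winning strategies simultaneously, on all subsequences of the play; the
      choices of player II then form a sequence tending weakly to 0
      ([null_finite]).
    - If for some [e] it is not null, then for a non-null [C] the set of [t] for
      which both parts [e <= f (v t)] and [f (v t) < e / 2] of [C] are non-null
      belongs to [U].  For the first part this is the rule of the game.  For the
      second, otherwise, a Hahn-Banach argument (in effect weak-star
      compactness of the dual ball modulo the ideal) would give one [f] with
      [e / 2 <= f (v t)] for [U]-many [t] ([not_null_lower]).  Hence a
      sequence [t k] can be chosen on which every 0-1 pattern is realised by a
      functional of the dual ball ([not_null_independent]).  By Rosenthal's
      estimate it spans a copy of l_1 ([independent_lower], [ell1_copy]).
    Applied to an ultrafilter tending weakly to a point of the closure of a
    set, this dichotomy yields the Frechet-Urysohn property of bounded sets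
    ([frechet_urysohn_bounded]).  A general set is then covered by its
    intersections with closed balls, which are weakly closed. *)

(** * Sublinear functionals and the Hahn-Banach theorem *)

Section sublinear.
Context {R : realType} {X : lmodType R}.

Definition sublinear (p : X -> R) : Prop :=
  (forall x y, p (x + y) <= p x + p y) /\
  (forall t x, 0 < t -> p (t *: x) <= t * p x).

Lemma sublinear0 p : sublinear p -> p 0 = 0.
Proof.
move=> [_ pZ]; have := pZ 2 0 ltac:(by []); have := pZ 2^-1 0.
rewrite !scaler0 invr_gt0 => /(_ ltac:(by [])); lra.
Qed.

Lemma sublinearZ p t x : sublinear p -> 0 <= t -> p (t *: x) = t * p x.
Proof.
move=> sp; rewrite le_eqVlt => /predU1P[<-|t0].
  by rewrite scale0r mul0r sublinear0.
apply/eqP; rewrite eq_le sp.2//=.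
have := sp.2 t^-1 (t *: x); rewrite invr_gt0 => /(_ t0).
by rewrite scalerA mulVf ?gt_eqF// scale1r ler_pdivlMl.
Qed.

Lemma sublinear_ge p x : sublinear p -> - p (- x) <= p x.
Proof.
by move=> sp; rewrite lerNl -subr_ge0 opprK addrC -(sublinear0 sp) -(subrr x) sp.1.
Qed.

Definition convex_cone (C : set (X * R)) : Prop :=
  [/\ C (0, 0),
      forall w a w' a', C (w, a) -> C (w', a') -> C (w + w', a + a') &
      forall t w a, 0 < t -> C (w, a) -> C (t *: w, t * a)].

(** The infimal convolution of [p] with the cone: the largest sublinear
    functional that lies below [p] and respects the constraints [q w <= a]. *)
Lemma sublinear_cone p C : sublinear p -> convex_cone C ->
  (forall w a, C (w, a) -> 0 <= p (- w) + a) ->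
  exists q, [/\ sublinear q, forall x, q x <= p x &
                forall w a, C (w, a) -> q w <= a].
Proof.
move=> sp [C0 CD CZ] pC.
pose E x := [set p (x - c.1) + c.2 | c in C].
have Elb x : has_lbound (E x).
  exists (- p (- x)) => _ [[w a] /= Cwa <-].
  have := pC _ _ Cwa; have := sp.1 (x - w) (- x).
  rewrite addrAC subrr add0r => ? ?; lra.
have E0 x : E x !=set0 by exists (p (x - 0) + 0); exists (0, 0).
pose q x := inf (E x).
have qle x w a : C (w, a) -> q x <= p (x - w) + a.
  by move=> Cwa; apply: ge_inf => //; exists (w, a).
exists q; split.
- split=> [x y|t x t0].
    rewrite -lerBlDl; apply: lb_le_inf => // _ [[w a] /= Cwa <-].
    rewrite lerBlDl -lerBlDr; apply: lb_le_inf => // _ [[w' a'] /= Cwa' <-].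
    rewrite lerBlDr; apply: le_trans (qle _ _ _ (CD _ _ _ _ Cwa' Cwa)) _.
    have := sp.1 (x - w') (y - w); rewrite addrACA -opprD; lra.
  rewrite -ler_pdivrMl//; apply: lb_le_inf => // _ [[w a] /= Cwa <-].
  rewrite ler_pdivrMl//; apply: le_trans (qle _ _ _ (CZ _ _ _ t0 Cwa)) _.
  by rewrite -scalerBr mulrDr lerD2r sp.2.
- by move=> x; have := qle x _ _ C0; rewrite subr0 addr0.
- by move=> w a /(qle w); rewrite subrr sublinear0// add0r.
Qed.

Lemma sublinear_inf_chain (p : X -> R) (A : set (X -> R)) : A !=set0 ->
  (forall s, A s -> sublinear s /\ forall x, s x <= p x) ->
  (forall s s', A s -> A s' -> (forall x, s x <= s' x) \/ (forall x, s' x <= s x)) ->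
  exists q, [/\ sublinear q, forall x, q x <= p x &
    forall s, A s -> forall x, q x <= s x].
Proof.
move=> [s0 As0] Ap Atot.
pose E x := [set s x | s in A].
have Elb x : has_lbound (E x).
  exists (- p (- x)) => _ [s /= /Ap[ss sp] <-].
  by apply: le_trans (sublinear_ge _ ss); rewrite lerN2.
have E0 x : E x !=set0 by exists (s0 x); exists s0.
pose q x := inf (E x).
have qle s x : A s -> q x <= s x.
  by move=> As; apply: ge_inf => //; exists s.
exists q; split=> //.
- split=> [x y|t x t0].
    rewrite -lerBlDl; apply: lb_le_inf => // _ [s /= As <-].
    rewrite lerBlDl -lerBlDr; apply: lb_le_inf => // _ [s' /= As' <-].
    rewrite lerBlDr; have [ss'|s's] := Atot _ _ As As'.
      apply: le_trans (qle _ _ As) _.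
      by apply: le_trans ((Ap _ As).1.1 _ _) _; rewrite lerD2r.
    apply: le_trans (qle _ _ As') _.
    by apply: le_trans ((Ap _ As').1.1 _ _) _; rewrite lerD2l.
  rewrite -ler_pdivrMl//; apply: lb_le_inf => // _ [s As <-].
  rewrite ler_pdivrMl//; apply: le_trans (qle _ _ As) _.
  by apply (Ap _ As).1.
- by move=> x; apply: le_trans (qle _ _ As0) _; exact: (Ap _ As0).2.
- by move=> s As x; exact: qle.
Qed.

(** Zorn's lemma, run on everywhere defined sublinear functionals; this
    replaces the usual extension of functionals from subspace to subspace. *)
Lemma sublinear_minimal p : sublinear p -> exists q, [/\ sublinear q,
  forall x, q x <= p x &
  forall q', sublinear q' -> (forall x, q' x <= q x) -> q' = q].
Proof.
move=> sp.
pose T := {q : X -> R | sublinear q /\ forall x, q x <= p x}.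
pose r (q q' : T) := `[< forall x, sval q' x <= sval q x >].
have [||||[q [sq qp]] qmin] := @Zorn T r.
- by move=> q; apply/asboolP.
- move=> q q' q'' /asboolP h /asboolP h'; apply/asboolP => x.
  exact: le_trans (h' x) (h x).
- move=> [q hq] [q' hq'] /asboolP h /asboolP h'; apply: eq_exist.
  by apply/funext => x; apply/eqP; rewrite eq_le h' h.
- move=> A Atot; have [[s As]|A0] := pselect (A !=set0); last first.
    by exists (exist _ p (conj sp (fun x => lexx _))) => s As; case: A0; exists s.
  have [||| q [sq qp qA]] := @sublinear_inf_chain p [set sval s | s in A].
  + by exists (sval s); exists s.
  + by move=> _ [s' _ <-]; exact: (svalP s').
  + move=> _ _ [s1 As1 <-] [s2 As2 <-].
    by have [/asboolP|/asboolP] := Atot _ _ As1 As2; [right|left].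
  exists (exist _ q (conj sq qp)) => s' As'; apply/asboolP => /= x.
  by apply: qA; exists s'.
- exists q; split=> // q' sq' q'q.
  have hq' : sublinear q' /\ forall x, q' x <= p x.
    by split=> // x; apply: le_trans (q'q x) (qp x).
  by have /(congr1 sval) := qmin (exist _ q' hq') (asboolT q'q).
Qed.

(** A minimal sublinear functional cannot be lowered by imposing
    [q (- y) <= - q y], a constraint that is always consistent. *)
Lemma sublinear_minimal_odd q : sublinear q ->
  (forall q', sublinear q' -> (forall x, q' x <= q x) -> q' = q) ->
  forall y, q (- y) = - q y.
Proof.
move=> sq qmin y.
have [||q' [sq' q'q q'C]] := @sublinear_cone q
  [set (- (t *: y), - (t * q y)) | t in [set t | 0 <= t]] sq.
- split.
  + by exists 0 => //=; rewrite scale0r mul0r !oppr0.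
  + move=> _ _ _ _ [t /= t0 [<- <-]] [t' /= t'0 [<- <-]].
    exists (t + t'); first exact: addr_ge0.
    by rewrite scalerDl mulrDl !opprD.
  + move=> s _ _ s0 [t /= t0 [<- <-]]; exists (s * t).
      by rewrite /= mulr_ge0// ltW.
    by rewrite -scalerA -mulrA scalerN mulrN.
- by move=> _ _ [t /= t0 [<- <-]]; rewrite opprK sublinearZ// subrr.
have q'E := qmin _ sq' q'q; rewrite q'E in q'C.
apply/eqP; rewrite eq_le; apply/andP; split; last first.
  by have := sublinear_ge (- y) sq; rewrite opprK.
by apply: q'C; exists 1 => //=; rewrite scale1r mul1r.
Qed.

(** A sublinear functional that is odd is linear, so the minimal one below the
    functional of [sublinear_cone] is the one sought.  Extension theorems,
    separation and compactness of the dual ball are all obtained by choosing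
    the cone of constraints. *)
Lemma hahn_banach_cone p C : sublinear p -> convex_cone C ->
  (forall w a, C (w, a) -> 0 <= p (- w) + a) ->
  exists f : {linear X -> R^o}, (forall x, f x <= p x) /\
                forall w a, C (w, a) -> f w <= a.
Proof.
move=> sp cC /(sublinear_cone sp cC)[p' [sp' p'p p'C]].
have [q [sq qp' /(sublinear_minimal_odd sq) qN]] := sublinear_minimal sp'.
have q_lin : linear (q : X -> R^o).
  have qD x y : q (x + y) = q x + q y.
    apply/eqP; rewrite eq_le sq.1/=.
    have := sq.1 (- x) (- y); rewrite -opprD !qN -opprD lerN2; exact.
  move=> a x y; rewrite qD; congr (_ + _).
  have [a0|a0] := leP 0 a; first exact: sublinearZ.
  rewrite -[a]opprK scaleNr qN sublinearZ// ?oppr_ge0 1?ltW//.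
  by rewrite scaleNr.
pose f : {linear X -> R^o} := HB.pack (q : X -> R^o)
  (GRing.isLinear.Build R X R^o *:%R q q_lin).
exists f; split=> [x|w a /p'C]; first exact: le_trans (qp' x) (p'p x).
by apply: le_trans; exact: qp'.
Qed.

End sublinear.

(** * The dual ball *)

Lemma ex_invS_lt (R : realType) (e : R) : 0 < e -> exists k : nat, k.+1%:R^-1 < e.
Proof.
by move=> e0; exists (Num.truncn e^-1); rewrite invf_plt ?posrE// truncnS_gt.
Qed.

Section dual_ball.
Context {R : realType} {X : normedModType R}.

Lemma sublinear_norm (M : R) : 0 <= M -> sublinear (fun x : X => M * `|x|).
Proof.
move=> M0; split=> [x y|t x t0].
  by rewrite -mulrDr ler_wpM2l// ler_normD.
by rewrite normrZ gtr0_norm// mulrCA.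
Qed.

(** The closed unit ball of the dual: since [x] may be replaced by [- x], the
    one-sided bound also bounds [`|f x|]. *)
Definition dual_ball : set {linear X -> R^o} := [set f | forall x, f x <= `|x|].

Lemma dual_ballN (f : {linear X -> R^o}) :
  dual_ball f -> dual_ball (-1 \*: f).
Proof. by move=> fb x; rewrite /= scaleN1r -linearN -normrN; exact: fb. Qed.

Lemma dual_ball_norm (f : {linear X -> R^o}) x : dual_ball f -> `|f x| <= `|x|.
Proof.
by move=> fb; rewrite ler_norml fb andbT lerNl -linearN -normrN fb.
Qed.

(** Weak-star compactness of the dual ball relative to an ideal [N]: if [C] is not
    in [N], some functional of the dual ball belongs to every closed half-space
    containing [C] up to a set in [N].  The
    pairs [(w, a)] describing these half-spaces form a convex cone, and any
    element of [C] outside a set of [N] witnesses its consistency. *)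
Lemma dual_ball_mod_ideal (N : set (set {linear X -> R^o}))
    (C : set {linear X -> R^o}) : C `<=` dual_ball ->
  N set0 -> (forall A B, A `<=` B -> N B -> N A) ->
  (forall A B, N A -> N B -> N (A `|` B)) -> ~ N C ->
  exists2 f, dual_ball f &
    forall w a, N (C `&` [set g | a < g w]) -> f w <= a.
Proof.
move=> CK N0 NS NU NC.
have [| |f [fK fC]] := @hahn_banach_cone R X _
  [set wa | N (C `&` [set g | wa.2 < g wa.1])] (sublinear_norm ler01).
- split=> /=.
  + by apply: NS N0 => g [_]; rewrite /= linear0 ltxx.
  + move=> w a w' a' h h'; apply: NS (NU _ _ h h') => g [Cg] /=.
    rewrite linearD /= => agw.
    have [|gwa] := ltP a (g w); first by left.
    right; split=> //=; rewrite ltNge; apply/negP => gwa'.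
    by move: agw; rewrite ltNge lerD.
  + move=> t w a t0; apply: NS => g [Cg]/=.
    by rewrite linearZ /= ltr_pM2l.
- move=> w a /= Nwa; rewrite mul1r; rewrite leNgt; apply/negP => aw.
  apply: NC; apply: NS Nwa => g Cg; split=> //=.
  by have := CK _ Cg (- w); rewrite linearN /=; lra.
- by exists f => // x; have := fK x; rewrite mul1r.
Qed.

End dual_ball.
Arguments dual_ball {R} X.

(** * The game along an ultrafilter *)

Section game.
Context {R : realType} {X : normedModType R} {T : Type} (U : set_system T)
  (v : T -> X).

(** A strategy of player I is a well-founded tree, so that the plays that follow
    it are finite and facts on them are proved by induction. *)
Inductive strategy := Stop | Play (A : set T) (next : T -> strategy).

Definition upper (e : R) (t : T) : set {linear X -> R^o} := [set f | e <= f (v t)].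

(** The set [C] records the functionals that have been at least [e] on all the
    choices of player II so far. *)
Fixpoint winning (e : R) (st : strategy) (C : set {linear X -> R^o}) : Prop :=
  match st with
  | Stop => C = set0
  | Play A next => U A /\ forall t, A t -> winning e (next t) (C `&` upper e t)
  end.

Definition null e C := exists st, winning e st C.

Lemma null0 e : null e set0. Proof. by exists Stop. Qed.

Lemma nullS e A B : A `<=` B -> null e B -> null e A.
Proof.
move=> AB [st]; elim: st A B AB => [|D next IH] A B AB /=.
  by move=> B0; exists Stop; rewrite /= -subset0 -B0.
move=> [UD Dn].
have /choice[next' next'P] : forall t, exists st, D t -> winning e st (A `&` upper e t).
  move=> t; have [Dt|] := pselect (D t); last by exists Stop.
  have ABt : A `&` upper e t `<=` B `&` upper e t by move=> f [/AB].
  by have [st stw] := IH t _ _ ABt (Dn t Dt); exists st.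
by exists (Play D next'); split=> // t /next'P.
Qed.

Lemma null_play e C A : U A -> (forall t, A t -> null e (C `&` upper e t)) ->
  null e C.
Proof.
move=> UA h.
have /choice[next nextP] : forall t, exists st, A t -> winning e st (C `&` upper e t).
  by move=> t; have [/h[st ?]|] := pselect (A t); [exists st|exists Stop].
by exists (Play A next).
Qed.

(** Player I plays first against [A], and, once [A] is exhausted, against what is
    left of [B]; the moves made meanwhile only shrink [B]. *)
Lemma nullU e A B : null e A -> null e B -> null e (A `|` B).
Proof.
move=> [st]; elim: st A B => [|D next IH] A B /=.
  by move=> ->; rewrite set0U.
move=> [UD Dn] nB; apply: (null_play UD) => t Dt.
rewrite setIUl; apply: IH (Dn t Dt) _.
by apply: nullS nB; exact: subIsetl.
Qed.

Context (UU : UltraFilter U)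
  (v0 : forall f, dual_ball X f -> forall e, 0 < e -> U [set t | f (v t) < e]).

Lemma not_null_upper e C : ~ null e C -> U [set t | ~ null e (C `&` upper e t)].
Proof.
move=> nC; have [UA|//] := in_ultra_setVsetC [set t | null e (C `&` upper e t)] UU.
by exfalso; apply: nC; apply: (null_play UA).
Qed.

(** Otherwise [U]-many half-spaces [d <= f (v t)] contain [C] up to a null set, so
    that a single [f] in the dual ball belongs to all of them, against the
    convergence of [f (v t)] to 0. *)
Lemma not_null_lower e d C : 0 < d -> C `<=` dual_ball X -> ~ null e C ->
  U [set t | ~ null e (C `&` [set f | f (v t) < d])].
Proof.
move=> d0 CK nC.
have [UA|//] := in_ultra_setVsetC [set t | null e (C `&` [set f | f (v t) < d])] UU.
exfalso.
have [f fK fN] := dual_ball_mod_ideal CK (null0 e) (@nullS e) (@nullU e) nC.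
have [t [/= nt fvt]] := filter_ex (filterI UA (v0 fK d0)).
have : f (- v t) <= - d.
  by apply: fN; apply: nullS nt => g [Cg] /=; rewrite linearN /= ltrN2.
by rewrite linearN lerN2 leNgt fvt.
Qed.

(** Boolean independence of [s] modulo the null sets: requiring cells that are
    non-null, rather than nonempty, is what allows a further term to split all of
    them. *)
Fixpoint independent_on (e d : R) (s : seq T) (C : set {linear X -> R^o}) : Prop :=
  match s with
  | [::] => ~ null e C
  | t :: s' => independent_on e d s' (C `&` upper e t) /\
               independent_on e d s' (C `&` [set f | f (v t) < d])
  end.

Lemma independent_on_rcons e d s C : 0 < d -> C `<=` dual_ball X ->
  independent_on e d s C -> U [set t | independent_on e d (rcons s t) C].
Proof.
move=> d0; elim: s C => [|t s IH] C CK /=.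
  by move=> nC; apply: filterI; [exact: not_null_upper|exact: not_null_lower].
by case=> h h'; apply: filterI; apply: IH => // f [Cf _]; exact: CK.
Qed.

Lemma independent_on_ex e d t0 s C (S : pred nat) : independent_on e d s C ->
  exists2 f, C f & forall i, (i < size s)%N ->
    (if S i then e <= f (v (nth t0 s i)) else f (v (nth t0 s i)) < d).
Proof.
elim: s C S => [|t s IH] C S /=.
  move=> nC; have [//|/set0P[f Cf]] := eqVneq C set0.
    by move=> C0; case: nC; rewrite C0; exact: null0.
  by exists f.
case=> hu hl; case: (boolP (S 0)) => S0.
  have [f [Cf fu] fS] := IH _ (fun i => S i.+1) hu.
  by exists f => // -[_|i /fS//]; rewrite /= S0.
have [f [Cf fl] fS] := IH _ (fun i => S i.+1) hl.
by exists f => // -[_|i /fS//]; rewrite /= (negbTE S0).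
Qed.

(** The sequence is built one term at a time: the next one has to split the
    finitely many cells obtained so far into two non-null parts, and each split
    succeeds for [U]-many [t]. *)
Lemma not_null_independent e d (B : set T) : 0 < d -> ~ null e (dual_ball X) ->
  U B -> exists t_ : nat -> T, (forall n, B (t_ n)) /\
    forall (n : nat) (S : pred nat), exists2 f, dual_ball X f &
      forall i, (i < n)%N ->
        if S i then e <= f (v (t_ i)) else f (v (t_ i)) < d.
Proof.
move=> d0 nK UB.
have /choice[next nextP] : forall s, exists t, independent_on e d s (dual_ball X) ->
    B t /\ independent_on e d (rcons s t) (dual_ball X).
  move=> s; have [h|h] := pselect (independent_on e d s (dual_ball X)).
    have Uh := independent_on_rcons d0 (@subset_refl _ _) h.
    have [t [Bt ht]] := filter_ex (filterI UB Uh).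
    by exists t.
  by have [t _] := filter_ex UB; exists t.
pose s_ := fix s_ n := if n is n'.+1 then rcons (s_ n') (next (s_ n')) else [::].
have sI n : independent_on e d (s_ n) (dual_ball X).
  by elim: n => //= n /nextP[].
have sE n : s_ n = mkseq (next \o s_) n.
  by elim: n => // n IH; rewrite mkseqS -IH.
exists (next \o s_); split=> [n|n S]; first by have [] := nextP _ (sI n).
have [f fK fS] := independent_on_ex (next [::]) S (sI n).
exists f => // i ilt; have := fS i.
by rewrite sE size_mkseq nth_mkseq//; apply.
Qed.

Definition moves (st : strategy) : set T := if st is Play A _ then A else setT.
Definition reply (t : T) (st : strategy) : strategy :=
  if st is Play A next then if `[< A t >] then next t else Stop else Stop.

(** The moves of player II that are legal after every subsequence of the play
    [s], each subsequence being answered by the strategy [st] on its own. *)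
Fixpoint allowed (st : strategy) (s : seq T) : set T :=
  if s is t :: s' then allowed st s' `&` allowed (reply t st) s' else moves st.

Lemma allowed_near e st C s : winning e st C -> U (allowed st s).
Proof.
elim: s st C => [|t s IH] [|A next] C //=.
- by move=> _; exact: filterT.
- by case.
- by move=> C0; apply: filterI; exact: (IH Stop set0).
- move=> [UA wA]; apply: filterI; first exact: (IH (Play A next) C).
  case: asboolP => [/wA|_]; first exact: IH.
  exact: (IH Stop set0).
Qed.

Lemma allowed_skip st s s' : allowed st (s ++ s') `<=` allowed st s'.
Proof. by elim: s => // t s IH u /= [/IH]. Qed.

Lemma allowed_moves st s : allowed st s `<=` moves st.
Proof. by rewrite -[s]cats0; exact: allowed_skip. Qed.

(** If [e <= f (v (t_ n))] held infinitely often, these terms would form a play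
    that follows [st] and leaves [f] in all the sets, including the last one,
    which is empty. *)
Lemma winning_finite e st C (t_ : nat -> T) k f : winning e st C -> C f ->
  (forall n, (k <= n)%N -> allowed st [seq t_ i | i <- iota k (n - k)] (t_ n)) ->
  exists N, forall n, (N <= n)%N -> f (v (t_ n)) < e.
Proof.
elim: st C k => [|A next IH] C k /=; first by move=> ->.
move=> [UA wA] Cf tA.
have [//|noN] := pselect (exists N, forall n, (N <= n)%N -> f (v (t_ n)) < e).
have [m [km em]] : exists m, (k <= m)%N /\ e <= f (v (t_ m)).
  apply: contrapT => nom; apply: noN; exists k => n kn.
  by rewrite ltNge; apply/negP => en; apply: nom; exists n.
have Am : A (t_ m) by have := allowed_moves (tA m km).
apply: (IH (t_ m) _ m.+1 (wA _ Am)); first by split.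
move=> n mn; have kn : (k <= n)%N by exact: leq_trans km (ltnW mn).
have := tA n kn.
(* Skip the terms before [m], answer [t_ m], and go on with the later ones. *)
have -> : (n - k = (m - k) + (n - m.+1).+1)%N by lia.
rewrite iotaD map_cat subnKC//= => /allowed_skip /= [_].
by rewrite asboolT.
Qed.

(** At stage [n] the term [t_ n] obeys the strategies for [e = 1/(j+1)], [j <= n],
    on all subsequences of the previous terms: finitely many constraints, each
    in [U]. *)
Lemma null_finite (B : set T) : U B ->
  (forall e, 0 < e -> null e (dual_ball X)) ->
  exists t_ : nat -> T, (forall n, B (t_ n)) /\
    forall f, dual_ball X f -> forall e, 0 < e ->
      exists N, forall n, (N <= n)%N -> f (v (t_ n)) < e.
Proof.
move=> UB nK.
have /choice[st stw] : forall j : nat, exists st, winning (j.+1%:R^-1) st (dual_ball X).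
  by move=> j; exact: nK.
have /choice[next nextP] : forall s : seq T, exists t, B t /\
    forall j : 'I_(size s).+1, allowed (st j) s t.
  move=> s; suff /filter_ex[t ht] : U [set t | B t /\
      forall j : 'I_(size s).+1, allowed (st j) s t] by exists t.
  apply: filterI => //.
  by apply: filter_forall => j; exact: allowed_near (stw j).
(* [next] only sees the whole history, hence the recursion on [s_]. *)
pose s_ := fix s_ n := if n is n'.+1 then rcons (s_ n') (next (s_ n')) else [::].
pose t_ := next \o s_.
have sE n : s_ n = mkseq t_ n.
  by elim: n => // n IH; rewrite mkseqS -IH.
exists t_; split=> [n|f fK e e0]; first by have [] := nextP (s_ n).
have [j je] := ex_invS_lt e0.
have [|N fN] := @winning_finite _ _ _ t_ j f (stw j) fK.
  move=> n jn; have [_] := nextP (s_ n).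
  have jlt : (j < (size (s_ n)).+1)%N by rewrite sE size_mkseq.
  move=> /(_ (Ordinal jlt)) /=; rewrite [in allowed _ _]sE /mkseq.
  rewrite -{1}(subnKC jn) iotaD map_cat => /allowed_skip.
  by rewrite add0n.
by exists N => n /fN fn; exact: lt_trans je.
Qed.

End game.

(** * Copies of l_1 *)

Lemma continuous_linear_lipschitz (R : realType) (V W : normedModType R)
    (f : {linear V -> W}) :
  continuous f <-> exists2 M, 0 < M & forall x, `|f x| <= M * `|x|.
Proof.
rewrite -linear_bounded_continuous linear_boundedP; split.
  move=> h; near (pinfty_nbhs R) => M; exists M; last by near: M.
  by near: M; exact: nbhs_pinfty_gt.
move=> [M M0 fM]; exists M; split=> [|r Mr x]; first exact: num_real.
by apply: le_trans (fM x) _; rewrite ler_wpM2r// ltW.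
Unshelve. all: by end_near. Qed.

Section ell1_synthesis.
Context {R : realType}.

Lemma ell1_partial (u : ell1 R) n : \sum_(i < n) `|u i| <= `|u|.
Proof.
have nd : nondecreasing_seq [normed series u].
  by apply: nondecreasing_series => k _ _; exact: normr_ge0.
have := nondecreasing_cvgn_le nd (@is_cvg_ell1 R u) n.
suff -> : [normed series u] n = \sum_(i < n) `|u i| by [].
by rewrite /normed_series_of seriesEord.
Qed.

Lemma ell1_synthesis (X : completeNormedModType R) (x : nat -> X) (M : R) :
  (forall n, `|x n| <= M) ->
  exists2 f : {linear ell1 R -> X},
    forall u : ell1 R, series (fun i => u i *: x i) @ \oo --> f u & continuous f.
Proof.
move=> xM; have M0 : 0 <= M by exact: le_trans (xM 0).
have cvs (u : ell1 R) : cvgn (series (fun i => u i *: x i)).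
  apply: normed_cvg.
  apply: (@series_le_cvg _ _ (M *: (fun n => `|u n|) : R^nat)) => [n|n|n|] /=.
  - exact: normr_ge0.
  - by rewrite mulr_ge0.
  - by rewrite normrZ mulrC ler_wpM2r.
  - by apply: is_cvg_seriesZ; exact: is_cvg_ell1.
pose F (u : ell1 R) : X := limn (series (fun i => u i *: x i)).
have F_lin : linear F.
  move=> a u w; rewrite /F; apply: cvg_lim => //.
  have -> : series (fun i => (a *: u + w) i *: x i) =
      a \*: (series (fun i => u i *: x i)) \+ series (fun i => w i *: x i).
    apply/funext => n; rewrite /series/= scaler_sumr -big_split/=.
    by apply: eq_bigr => i _; rewrite scalerDl scalerA.
  by apply: cvgD; [apply: cvgZr; exact: cvs|exact: cvs].
pose f : {linear ell1 R -> X} := HB.pack F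
  (GRing.isLinear.Build R (ell1 R) X *:%R F F_lin).
exists f; first by move=> u; exact: cvs.
apply/continuous_linear_lipschitz; exists (M + 1); first by rewrite ltr_wpDl.
move=> u; rewrite -(cvg_lim (@Rhausdorff R) (cvg_norm (cvs u))).
apply: limr_le; first exact: is_cvg_norm.
apply: nearW => n; rewrite seriesEord.
apply: le_trans (ler_norm_sum _ _ _) _.
apply: (@le_trans _ _ (M * \sum_(i < n) `|u i|)).
  rewrite mulr_sumr; apply: ler_sum => i _.
  by rewrite normrZ mulrC ler_wpM2r.
apply: le_trans (ler_wpM2l M0 (ell1_partial u n)) _.
by rewrite ler_wpM2r// lerDl.
Qed.

(** The synthesis operator is bounded below on finite sums, hence on l_1; its
    inverse on the range is therefore continuous. *)
Lemma ell1_copy (X : completeNormedModType R) (x : nat -> X) (M c : R) :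
  (forall n, `|x n| <= M) -> 0 < c ->
  (forall (a : nat -> R) n, c * \sum_(i < n) `|a i| <= `|\sum_(i < n) a i *: x i|) ->
  contains_isomorphic_copy X (ell1 R).
Proof.
move=> /ell1_synthesis[f fx cf] c0 xc.
have lower u : c * `|u| <= `|f u|.
  have cu : c * [normed series u] n @[n --> \oo] --> c * `|u|.
    by apply: cvgMl_tmp; exact: (@is_cvg_ell1 R u).
  apply: (ler_cvg_to cu (cvg_norm (fx u))).
  apply: nearW => n; rewrite /normed_series_of !seriesEord; exact: xc.
have finj : injective f.
  move=> u w fuw; apply/eqP; rewrite -subr_eq0 -normr_le0.
  by have := lower (u - w); rewrite linearB fuw subrr normr0 pmulr_rle0.
exists (range f).
  split=> [|a y z]; first by apply/mem_set; exists 0 => //; rewrite linear0.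
  move=> /set_mem[u _ <-] /set_mem[w _ <-]; apply/mem_set.
  by exists (a *: u + w) => //; rewrite linearP.
pose g (y : X) : ell1 R := xget 0 [set u | f u = y].
have fK : cancel f g.
  by move=> u; apply: finj; exact: (@xgetI _ 0 [set w | f w = f u] u).
exists f; split=> //.
- split=> [u _|u w _ _|y //]; [by exists u|exact: finj].
- exists g => //; apply/subspace_continuousP => _ [u _ <-].
  apply/cvgrPdist_le => e e0; rewrite near_withinE.
  near=> y => -[w _ fwy]; rewrite -fwy.
  suff h : `|u - w| <= e by rewrite -(fK u) -(fK w) in h.
  rewrite -(ler_pM2l c0); apply: le_trans (lower _) _.
  rewrite linearB/= fwy; near: y; apply: cvgr_dist_le; first exact: cvg_id.
  exact: mulr_gt0.
Unshelve. all: by end_near. Qed.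

(** Rosenthal's estimate: take [f] large and [g] small where [a i] is
    nonnegative and conversely elsewhere; then each term of
    [(f - g) (\sum_i a i *: x i)] is at least [(e - d) * `|a i|], while
    [f - g] has norm at most 2. *)
Lemma independent_lower (X : normedModType R) (x : nat -> X) (e d : R) : d < e ->
  (forall (n : nat) (S : pred nat), exists2 f, dual_ball X f &
      forall i, (i < n)%N -> if S i then e <= f (x i) else f (x i) < d) ->
  forall (a : nat -> R) n,
    (e - d) / 2 * \sum_(i < n) `|a i| <= `|\sum_(i < n) a i *: x i|.
Proof.
move=> de xi a n.
have [f fK fS] := xi n (fun i => 0 <= a i).
have [g gK gS] := xi n (fun i => ~~ (0 <= a i)).
set y : X := \sum_(i < n) a i *: x i.
have : (e - d) * \sum_(i < n) `|a i| <= f y - g y.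
  have hy (h : {linear X -> R^o}) : h y = \sum_(i < n) a i * h (x i) :> R.
    by rewrite linear_sum; apply: eq_bigr => i _; rewrite linearZ.
  rewrite !hy -sumrB mulr_sumr; apply: ler_sum => i _; rewrite -mulrBr.
  have := fS i (ltn_ord i); have := gS i (ltn_ord i).
  have [ai0|ai0] := leP 0 (a i) => /= ? ?.
    by rewrite ger0_norm// [leLHS]mulrC ler_wpM2l//; lra.
  by rewrite ltr0_norm// [leLHS]mulrC mulNr -mulrN ler_wnM2l ?(ltW ai0)//; lra.
have := fK y; have := gK (- y); rewrite linearN normrN; lra.
Qed.

End ell1_synthesis.

(** The two outcomes of the game; a sequence is weakly null as soon as
    [limsup f (v (t_ n)) <= 0] for all [f] in the dual ball, because the ball is
    symmetric. *)
Lemma frechet_urysohn_dichotomy (R : realType) (X : completeNormedModType R)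
  (T : Type) (U : set_system T) (v : T -> X) (M : R) (B : set T) :
  UltraFilter U -> U B ->
  (forall t, `|v t| <= M) ->
  (forall f, dual_ball X f -> forall e, 0 < e -> U [set t | f (v t) < e]) ->
  ~ contains_isomorphic_copy X (ell1 R) ->
  exists t_ : nat -> T, (forall n, B (t_ n)) /\
    forall f, dual_ball X f -> f (v (t_ n)) @[n --> \oo] --> (0 : R).
Proof.
move=> UU UB vM v0 noell1.
have [nK|] := pselect (forall e : R, 0 < e -> null U v e (dual_ball X)).
  have [t_ [tB tv]] := null_finite UU UB nK.
  exists t_; split=> // f fK; apply/cvgrPdist_lt => e e0.
  have [N1 fN1] := tv _ fK _ e0.
  have [N2 fN2] := tv _ (dual_ballN fK) _ e0.
  exists (maxn N1 N2) => // n /=; rewrite geq_max => /andP[/fN1 h1 /fN2 /= h2].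
  by rewrite sub0r normrN ltr_norml h1 andbT ltrNl -scaleN1r.
move=> /existsNP[e /not_implyP[e0 nK]]; exfalso; apply: noell1.
have [t_ [_ tI]] := not_null_independent UU v0 (divr_gt0 e0 (ltr0Sn R 1)) nK UB.
have de : e / 2 < e by rewrite ltr_pdivrMr// ltr_pMr// ltr1n.
apply: (@ell1_copy _ _ (v \o t_) M ((e - e / 2) / 2)) => [n||a n].
- exact: vM.
- by rewrite divr_gt0// subr_gt0.
- exact: independent_lower.
Qed.

(** * The weak topology *)

Section weak_topology.
Context {R : realType} {X : normedModType R}.

Lemma dual_ball_continuous (f : {linear X -> R^o}) : dual_ball X f -> continuous f.
Proof.
move=> fK; apply/continuous_linear_lipschitz; exists 1 => // x.
by rewrite mul1r; exact: dual_ball_norm.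
Qed.

(** Functionals in the dual ball suffice to describe the weak topology. *)
Lemma continuous_dual_ball (f : {linear X -> R^o}) : continuous f ->
  exists M g, [/\ 0 < M, dual_ball X g & forall x, f x = M * g x].
Proof.
move=> /continuous_linear_lipschitz[M M0 fM]; exists M, (M^-1 \*: f); split=> // x.
  rewrite /= -[_ *: _]/(M^-1 * _) ler_pdivrMl//.
  exact: le_trans (ler_norm _) (fM x).
by rewrite /= -[_ *: _]/(M^-1 * _) mulVKf// gt_eqF.
Qed.

Lemma cvg_weak (T : Type) (F : set_system T) (h : T -> X) (x : X) : Filter F ->
  (forall f, dual_ball X f -> f (h t) @[t --> F] --> f x) ->
  h @ F --> (x : weak X).
Proof.
move=> FF hx; apply/(@cvg_sup _ _ (@weak_family R X)) => -[f cf].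
move=> A /= [_ [[W oW <-] Wfx] WA].
apply: filterS WA _; have [M [g [_ gK fg]]] := continuous_dual_ball cf.
have fhx : f (h t) @[t --> F] --> f x.
  have -> : (fun t => f (h t)) = (fun t => M * g (h t)) by apply/funext.
  by rewrite fg; apply: cvgMl_tmp; exact: hx.
by apply: fhx; apply: open_nbhs_nbhs; split.
Qed.

Lemma weak_continuous (f : {linear X -> R^o}) : continuous f ->
  continuous (f : weak X -> R).
Proof.
move=> cf x.
pose i : {f : {linear X -> R^o} | continuous f} := exist _ f cf.
have h := (@cvg_sup _ _ (@weak_family R X) (nbhs (x : weak X)) x
  (nbhs_filter (x : weak X))).1 (@cvg_id _ (nbhs (x : weak X))) i.
by apply: cvg_trans (cvg_app f h) _; exact: initial_continuous.
Qed.

Lemma weak_nbhs (x : X) (V : set X) :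
  nbhs (x : weak X) V -> nbhs x V.
Proof.
have h : (id : X -> X) @ x --> (x : weak X).
  by apply: cvg_weak => f fK; exact: dual_ball_continuous.
exact: h.
Qed.

End weak_topology.

Lemma cvg_set_type (S : topologicalType) (A : set S) (T : Type) (F : set_system T)
  (h : T -> A) (x : A) : Filter F ->
  set_val (h t) @[t --> F] --> set_val x -> h @ F --> x.
Proof.
move=> FF hx W [_ [[V oV <-] Vx] VW]; apply: filterS VW _.
by apply: hx; apply: open_nbhs_nbhs; split.
Qed.

Lemma set_val_continuous (S : topologicalType) (A : set S) :
  continuous (set_val : A -> S).
Proof. exact: initial_continuous. Qed.

(** A point [x] of the closure of [B] is the limit of an ultrafilter containing
    [B]; the dichotomy applies to the family [t - x]. *)
Lemma frechet_urysohn_bounded (R : realType) (X : completeNormedModType R) (A : set X) :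
  ~ contains_isomorphic_copy X (ell1 R) -> bounded_set A -> weakly_Frechet_Urysohn A.
Proof.
move=> nol1 bA B x; rewrite closureEcvg => -[G GF [Gx BG]].
have [U [UU GU]] := ultraFilterLemma GF.
have UB : U B by apply: GU; exact: BG.
have [M M0 AM] : exists2 M, 0 < M & forall a, A a -> `|a| <= M.
  have [M M0 /= AM] := ex_strict_bound_gt0 bA; by exists M => // a /AM/ltW.
pose v (t : @set_type (weak X) A) : X := (set_val t : X) - (set_val x : X).
have valM (t : @set_type (weak X) A) : `|set_val t : X| <= M := AM _ (set_valP t).
have vM t : `|v t| <= M + M.
  by apply: le_trans (ler_normB _ _) _; apply: lerD; exact: valM.
have v0 f : dual_ball X f -> forall e, 0 < e -> U [set t | f (v t) < e].
  move=> fK e e0.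
  have fc := weak_continuous (dual_ball_continuous fK).
  have : (f \o set_val) t @[t --> U] --> f (set_val x).
    apply: cvg_trans (continuous_comp _ _); last exact: fc.
      by apply: cvg_app; apply: subset_trans GU.
    exact: set_val_continuous.
  move=> /cvgrPdist_lt/(_ _ e0); apply: filterS => t /= h.
  rewrite linearB; apply: le_lt_trans (ler_norm _) _.
  by rewrite distrC.
have [t_ [tB tv]] := frechet_urysohn_dichotomy UU UB vM v0 nol1.
exists t_ => //; apply: cvg_set_type; apply: cvg_weak => f fK.
have := tv f fK; rewrite /v => h.
apply/subr_cvg0.
by under eq_cvg do rewrite -linearB.
Qed.

(** The constraints [t * `|x| <= f (t *: x)], for [0 <= t], are consistent since
    the norm is homogeneous. *)
Lemma norming (R : realType) (X : normedModType R) (x : X) :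
  exists2 f, dual_ball X f & `|x| <= f x.
Proof.
have [| |f [fK fC]] := @hahn_banach_cone R X _
  [set wa | exists2 t : R, 0 <= t & wa = (- (t *: x), - (t * `|x|))] (sublinear_norm ler01).
- split=> /=.
  + by exists 0 => //; rewrite scale0r mul0r !oppr0.
  + move=> _ _ _ _ [t t0 [-> ->]] [t' t'0 [-> ->]]; exists (t + t'); first exact: addr_ge0.
    by rewrite scalerDl mulrDl !opprD.
  + move=> s _ _ s0 [t t0 [-> ->]]; exists (s * t); first by rewrite mulr_ge0// ltW.
    by rewrite !mulrN -mulrA scalerN scalerA.
- by move=> _ _ [t t0 [-> ->]]; rewrite opprK mul1r normrZ ger0_norm// subrr.
exists f; first by move=> y; have := fK y; rewrite mul1r.
have : f (- (1 *: x)) <= - (1 * `|x|) by apply: fC; exists 1.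
by rewrite scale1r mul1r linearN lerN2.
Qed.

(** A norming functional of a point outside the ball is greater than [r] on a
    weak neighbourhood of this point. *)
Lemma closed_ball_weak (R : realType) (X : normedModType R) (A : set X) (r : R) :
  relatively_weakly_closed A (A `&` [set x | `|x| <= r]).
Proof.
split; first exact: subIsetl.
rewrite -[X in closed X]setCK; apply: open_closedC; rewrite openE => a /= aA.
have {}aA : ~ (`|set_val a : X| <= r).
  by move=> ar; apply: aA; split=> //; exact: set_valP.
have [f fK fa] := norming (set_val a : X).
have fc := weak_continuous (dual_ball_continuous fK).
have cc : (f \o set_val) @ a --> f (set_val a).
  exact: (cvg_comp _ _ (@set_val_continuous (weak X) A a) (fc _)).
have ra : r < f (set_val a : X) by apply: lt_le_trans fa; rewrite ltNge; apply/negP.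
have := @cvgr_gt _ _ _ (nbhs_filter a) _ _ cc _ ra.
apply: filterS => b /= rb [_ br].
by have := le_trans (fK _) br; rewrite leNgt rb.
Qed.

(** * Separability and Baire category *)

Section separability.
Context {R : realType} {X : normedModType R}.

(** Approximating [A] from outside is enough; this form is inherited by
    subsets. *)
Lemma separable_setP (A : set X) :
  separable_set A <-> exists2 D : set X, countable D & A `<=` closure D.
Proof.
split=> [[D0 cD0 dD0]|[D cD AD]].
  exists (set_val @` D0); first exact: (sub_countable (card_image_le _ _) cD0).
  move=> a Aa V; rewrite nbhsE => -[W [oW Wa] WV].
  have [|a' [Wa' Da']] := dD0 (set_val @^-1` W) _ (ex_intro2 _ _ W oW erefl).
    by exists (exist _ a (mem_set Aa)).
  by exists (set_val a'); split; [exists a'|exact: WV].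
have [[a0 Aa0]|A0] := pselect (A !=set0); last first.
  exists set0 => // O [a _]; case: A0; exists (set_val a); exact: set_valP.
(* Pick a point of [A] within [1/(k+1)] of each [d] in [D], when there is one. *)
pose P (p : X * nat) (b : A) := `|set_val b - p.1| < p.2.+1%:R^-1.
have /choice[c cP] : forall p, exists a : A, (exists b, P p b) -> P p a.
  move=> p; have [[b Pb]|nP] := pselect (exists b, P p b); first by exists b.
  by exists (exist _ a0 (mem_set Aa0)).
exists (c @` (D `*` [set: nat])).
  by apply: (sub_countable (card_image_le _ _)); exact: countableX.
move=> O [a Oa] [V oV VO]; rewrite -VO in Oa *.
have /nbhs_ballP[e /= e0 aV] : nbhs (set_val a) V by apply: open_nbhs_nbhs.
have e20 : 0 < e / 2 by rewrite divr_gt0.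
have [k ke] := ex_invS_lt e20.
have k0 : 0 < k.+1%:R^-1 :> R by rewrite invr_gt0.
have [d [Dd]] := AD _ (set_valP a) _ (nbhsx_ballx (set_val a) _ k0).
rewrite -ball_normE /= => ad.
exists (c (d, k)); split; last by exists (d, k).
apply: aV; rewrite -ball_normE /=.
have : P (d, k) (c (d, k)) by apply: cP; exists a; rewrite /P/=.
rewrite /P /= distrC => cd; rewrite -(subrKA d).
apply: le_lt_trans (ler_normD _ _) _; rewrite [e]splitr.
by apply: ltrD; [exact: lt_trans ad ke|exact: lt_trans cd ke].
Qed.

Lemma separable_subset (A B : set X) : B `<=` A -> separable_set A -> separable_set B.
Proof.
move=> BA /separable_setP[D cD AD]; apply/separable_setP; exists D => //.
exact: subset_trans AD.
Qed.

End separability.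

Lemma bounded_implies_decomposition (R : realType) (X : normedModType R) :
  (forall A : set X, bounded_set A -> separable_set A -> weakly_Frechet_Urysohn A) ->
  forall A : set X, separable_set A ->
         exists A_ : nat -> set X,
           [/\ forall n, relatively_weakly_closed A (A_ n),
               A = \bigcup_n A_ n &
               forall n, weakly_Frechet_Urysohn (A_ n)].
Proof.
move=> h A sA; exists (fun n => A `&` [set x | `|x| <= n%:R]); split.
- move=> n; exact: closed_ball_weak.
- rewrite -setI_bigcupr; apply/seteqP; split=> [x Ax|x []//]; split=> //.
  exists (Num.truncn `|x|).+1 => //=; exact/ltW/truncnS_gt.
- move=> n; apply: h; last exact: separable_subset sA.
  exists n%:R; split; first exact: num_real.
  by move=> M nM x /= [_ xn]; exact: le_trans xn (ltW nM).
Qed.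

(** Baire's theorem in the closed subset [A], by nested balls.  The last
    hypothesis says that each [F n] is relatively closed in [A]. *)
Lemma baire_closed (R : realType) (X : completeNormedModType R) (A : set X)
    (F : nat -> set X) : closed A -> A !=set0 -> A `<=` \bigcup_n F n ->
  (forall n y, A y -> ~ F n y ->
     exists2 r, 0 < r & forall z, A z -> `|z - y| < r -> ~ F n z) ->
  exists n a r, [/\ A a, 0 < r & forall z, A z -> `|z - a| < r -> F n z].
Proof.
move=> cA [a0 Aa0] AF Fclosed; apply: contrapT => noball.
pose Q n (p q : X * R) := A p.1 -> 0 < p.2 ->
  [/\ A q.1, 0 < q.2, q.2 <= n.+1%:R^-1, `|q.1 - p.1| + q.2 <= p.2 &
      forall w, A w -> `|w - q.1| <= q.2 -> ~ F n w].
have /choice[next nextP] : forall np : nat * (X * R), exists q, Q np.1 np.2 q.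
  move=> [n [y r]]; have [[Ay r0]|nAr] := pselect (A y /\ 0 < r); last first.
    by exists (y, r) => Ay r0; case: nAr.
  have [z [Az zy nFz]] : exists z, [/\ A z, `|z - y| < r & ~ F n z].
    apply: contrapT => h; apply: noball; exists n, y, r; split=> // z Az zr.
    by apply: contrapT => nFz; apply: h; exists z.
  have [s s0 sF] := Fclosed _ _ Az nFz.
  pose r' := Num.min (Num.min (s / 2) n.+1%:R^-1) (r - `|z - y|).
  exists (z, r') => _ _ /=; split=> //.
  - by rewrite !lt_min divr_gt0//= invr_gt0 ltr0Sn subr_gt0.
  - by rewrite !ge_min lexx orbT.
  - by rewrite -lerBrDl !ge_min lexx orbT.
  - move=> w Aw wz; apply: sF => //; apply: le_lt_trans wz _.
    rewrite !gt_min; apply/orP; left; apply/orP; left.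
    by rewrite ltr_pdivrMr// ltr_pMr// ltr1n.
pose s := fix s n := if n is m.+1 then next (m, s m) else (a0, 1 : R).
have sA n : A (s n).1 /\ 0 < (s n).2.
  by elim: n => [|n [h1 h2]] //=; have [] := nextP (n, s n) h1 h2.
have sS n : [/\ A (s n.+1).1, 0 < (s n.+1).2, (s n.+1).2 <= n.+1%:R^-1,
    `|(s n.+1).1 - (s n).1| + (s n.+1).2 <= (s n).2 &
    forall w, A w -> `|w - (s n.+1).1| <= (s n.+1).2 -> ~ F n w].
  exact: nextP (n, s n) (sA n).1 (sA n).2.
have nest n m : (n <= m)%N -> `|(s m).1 - (s n).1| + (s m).2 <= (s n).2.
  elim: m => [|m IH]; first by rewrite leqn0 => /eqP ->; rewrite subrr normr0 add0r.
  rewrite leq_eqVlt => /predU1P[->|/IH {}IH]; first by rewrite subrr normr0 add0r.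
  have [_ _ _ h _] := sS m; apply: le_trans IH; apply: le_trans _ (lerD (lexx _) h).
  by rewrite addrA lerD2r addrC -[(s m.+1).1 - _](subrKA (s m).1); exact: ler_normD.
have : cvg ((fst \o s) n @[n --> \oo]).
  apply: cauchy_cvg; apply: cauchy_exP => e e0.
  have [k ke] := ex_invS_lt e0.
  exists (s k.+1).1, k.+1 => // m /= km.
  rewrite -ball_normE /= distrC; have [_ _ h _ _] := sS k.
  apply: le_lt_trans ke; apply: le_trans h; apply: le_trans (nest _ _ km).
  by rewrite lerDl ltW//; exact: (sA m).2.
move=> /cvg_ex[l /= sl].
have Al : A l.
  apply: (@closed_cvg _ _ \oo _ (fst \o s) A cA _ l sl).
  by apply: nearW => n; exact: (sA n).1.
have ln n : `|l - (s n).1| <= (s n).2.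
  have : `|(fst \o s) k - (s n).1| @[k --> \oo] --> `|l - (s n).1|.
    by apply: cvg_norm; apply: cvgB => //; exact: cvg_cst.
  move=> h; apply: (ler_cvg_to h (cvg_cst _)); exists n => // m /= nm.
  by apply: le_trans (nest _ _ nm); rewrite lerDl ltW//; exact: (sA m).2.
have [n _ Fnl] := AF _ Al.
have [_ _ _ _ h] := sS n; exact: h Al (ln n.+1) Fnl.
Qed.

(** * Separated sequences *)

(** If singletons do not separate the pairs infinitely often, then [n k] tends to
    infinity; pass to a subsequence along which
    [n k < m k < n k' < m k' < n k''] and so on, and let [S] be the set of its
    [n k]. *)
Lemma separating_pairs (n m : nat -> nat) : (forall k, (n k < m k)%N) ->
  exists S : pred nat, forall K, exists2 k, (K <= k)%N & S (n k) != S (m k).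
Proof.
move=> nm; apply: contrapT => nS.
have evS (S : pred nat) : exists K, forall k, (K <= k)%N -> S (n k) = S (m k).
  apply: contrapT => nK; apply: nS; exists S => K; apply: contrapT => nk.
  apply: nK; exists K => k Kk; apply/eqP; apply: contrapT => /negP ?.
  by apply: nk; exists k.
have ninfty N : exists K, forall k, (K <= k)%N -> (N <= n k)%N.
  elim: N => [|N [K1 h1]]; first by exists 0%N.
  have [K2 h2] := evS (pred1 N); exists (maxn K1 K2) => k.
  rewrite geq_max => /andP[/h1 Nn /h2 /=]; rewrite ltn_neqAle Nn andbT => e.
  apply/negP => /eqP Nk; move: e; rewrite -Nk eqxx => /esym /eqP mk.
  by have := nm k; rewrite -Nk mk ltnn.
have /choice[next nextP] : forall k, exists k', (k < k')%N /\ (m k < n k')%N.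
  move=> k; have [K h] := ninfty (m k).+1; exists (maxn K k.+1).
  by split; [exact: leq_maxr|apply: h; exact: leq_maxl].
pose kk j := iter j next 0%N.
have kkS j : (kk j < kk j.+1)%N /\ (m (kk j) < n (kk j.+1))%N by exact: nextP.
have n_mono i j : (i <= j)%N -> (n (kk i) <= n (kk j))%N.
  elim: j => [|j IH]; first by rewrite leqn0 => /eqP ->.
  rewrite leq_eqVlt => /predU1P[->//|/IH h]; apply: leq_trans h _.
  exact: ltnW (ltn_trans (nm _) (kkS j).2).
have [K SK] := evS (fun i => `[< exists j, i = n (kk j) >]).
have Kkk : (K <= kk K)%N.
  by elim: {SK}K => // K IH; exact: leq_ltn_trans IH (kkS K).1.
have := SK _ Kkk; rewrite asboolT; last by exists K.
move=> /esym /asboolP[j mn]; have [jK|Kj] := leqP j K.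
  by have := n_mono _ _ jK; rewrite -mn leqNgt nm.
by have := n_mono _ _ Kj; rewrite -mn leqNgt (kkS K).2.
Qed.

Section extension.
Context {R : realType} {X : normedModType R}.

(** Extension of a functional from the range of [f]: the cone is the graph of
    the functional to be extended. *)
Lemma functional_extension (Y : lmodType R) (f : {linear Y -> X})
    (phi : {linear Y -> R^o}) (M : R) : 0 <= M ->
  (forall y, phi y <= M * `|f y|) ->
  exists2 F : {linear X -> R^o}, continuous F & forall y, F (f y) = phi y.
Proof.
move=> M0 phiM.
have [| |F [FM FC]] := @hahn_banach_cone R X _
  (range (fun y => (f y, phi y : R))) (sublinear_norm M0).
- split.
  + by exists 0 => //; rewrite !linear0.
  + move=> _ _ _ _ [y _ [<- <-]] [z _ [<- <-]]; exists (y + z) => //.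
    by rewrite !linearD.
  + by move=> t _ _ _ [y _ [<- <-]]; exists (t *: y) => //; rewrite !linearZ.
- move=> _ _ [y _ [<- <-]]; have := phiM (- y); rewrite !linearN.
  by rewrite lerNl -subr_ge0 opprK addrC.
exists F.
  apply/continuous_linear_lipschitz; exists (M + 1); first by rewrite ltr_wpDl.
  move=> x; have M1 : M * `|x| <= (M + 1) * `|x| by rewrite ler_wpM2r// lerDl.
  apply: le_trans M1; rewrite ler_norml FM andbT lerNl -linearN -normrN; exact: FM.
move=> y; apply/eqP; rewrite eq_le FC/=; last by exists y.
by rewrite -lerN2 -!linearN; apply: FC; exists (- y) => //; rewrite !linearN.
Qed.

End extension.

Section unit_vectors.
Context {R : realType}.

Lemma cvg_series_unit (V : normedModType R) (x : nat -> V) n :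
  series (fun i => (i == n)%:R *: x i) @ \oo --> x n.
Proof.
apply: cvg_near_cst; exists n.+1 => // N /= nN.
rewrite seriesEord /= (bigD1 (Ordinal nN)) //= eqxx scale1r big1 ?addr0 // => i.
by rewrite -val_eqE /= => /negbTE ->; rewrite scale0r.
Qed.

Definition unit_fun n : nat -> R^o := fun i => (i == n)%:R.

Lemma cvg_unit_fun n : [normed series (unit_fun n)] @ \oo --> (1 : R).
Proof.
have -> : [normed series (unit_fun n)] = series (fun i => (i == n)%:R *: (1 : R^o)).
  apply/funext => k; rewrite /normed_series_of !seriesEord/=.
  by apply: eq_bigr => i _; rewrite /unit_fun normr_nat [RHS]mulr1.
exact: (@cvg_series_unit R^o (fun=> 1) n).
Qed.

Lemma unit_fun_ell1 n : unit_fun n \in @ell1_pred R.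
Proof. by apply/ell1_predP/cvg_ex; exists 1; exact: cvg_unit_fun. Qed.

Definition unit_vector n : ell1 R := Ell1 (unit_fun_ell1 n).

Lemma norm_unit_vector n : `|unit_vector n| = 1.
Proof. exact: (cvg_lim (@Rhausdorff R) (@cvg_unit_fun n)). Qed.

(** The functional that sums the coordinates indexed by [S] is bounded on l_1,
    hence on the copy, and extends to [X]. *)
Lemma copy_separated_sequence (X : normedModType R) :
  contains_isomorphic_copy X (ell1 R) ->
  exists2 x : nat -> X, (exists M, forall n, `|x n| <= M) &
    forall S : pred nat, exists2 F : {linear X -> R^o}, continuous F &
      forall n, F (x n) = (S n)%:R.
Proof.
move=> [V _ [f [[fV _ _] /continuous_linear_lipschitz[M M0 fM] [g fK cg]]]].
exists (f \o unit_vector).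
  by exists M => n; apply: le_trans (fM _) _; rewrite norm_unit_vector mulr1.
(* Continuity of the inverse at 0 bounds [f] from below, by homogeneity. *)
have [c c0 lower] : exists2 c, 0 < c & forall u, `|u| <= c * `|f u|.
  have V0 : V 0 by rewrite -(linear0 f); exact: fV.
  have /subspace_continuousP/(_ _ V0) := cg.
  have g0 : g 0 = 0 by rewrite -(linear0 f) fK.
  move=> /cvgrPdist_lt/(_ _ ltr01).
  rewrite near_withinE => /nbhs_ballP[r /= r0 gr].
  exists (2 / r) => [|u]; first by rewrite divr_gt0.
  have [->|u0] := eqVneq u 0; first by rewrite normr0 mulr_ge0// ltW// divr_gt0.
  have fu0 : 0 < `|f u|.
    rewrite normr_gt0; apply: contra_neq u0 => fu.
    by rewrite -(fK u) fu -(linear0 f) fK.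
  pose t := r / 2 / `|f u|.
  have t0 : 0 < t by rewrite !divr_gt0.
  have tr : ball 0 r (f (t *: u)).
    rewrite -ball_normE /= sub0r normrN linearZ normrZ gtr0_norm// divfK ?gt_eqF//.
    by rewrite ltr_pdivrMr// ltr_pMr// ltr1n.
  have : `|g 0 - g (f (t *: u))| < 1 := gr _ tr (fV _ I).
  rewrite g0 fK sub0r normrN normrZ gtr0_norm// => /ltW.
  rewrite -ler_pdivlMl// mulr1 => h; apply: le_trans h _.
  by rewrite /t !invf_div [leLHS]mulrC mulrAC.
move=> S.
have S1 n : `|(S n)%:R : R^o| <= 1 :> R by rewrite normr_nat; case: (S n).
have [phi phiS /continuous_linear_lipschitz[C C0 phiC]] :=
  @ell1_synthesis R R^o (fun n => (S n)%:R) 1 S1.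
have [||F cF Ff] := @functional_extension R X _ f phi (C * c).
- by rewrite mulr_ge0// ltW.
- move=> u; apply: le_trans (ler_norm _) _; apply: le_trans (phiC u) _.
  by rewrite -mulrA ler_wpM2l// ltW.
exists F => // n; rewrite /= Ff.
have h := @cvg_series_unit R^o (fun n => (S n)%:R) n.
exact: (cvg_unique _ (phiS (unit_vector n)) h).
Qed.

End unit_vectors.

(** * Failure of the decomposition in a space containing l_1 *)

Lemma ultra_bounded_cvg (R : realType) (G : set_system nat) (c : nat -> R) (M : R) :
  UltraFilter G -> (forall n, `|c n| <= M) -> exists l : R, c @ G --> l.
Proof.
move=> GU cM.
have [|l [_ lc]] := @segment_compact R (- M) M (c @ G) _.
  by apply: nearW => n /=; rewrite in_itv/= -ler_norml.
exists l => B Bl; have [//|nB] := in_ultra_setVsetC (c @^-1` B) GU.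
by have [y [nBy By]] := lc (~` B) B nB Bl.
Qed.

(** Membership in [iterated G] means that for [G]-most [n], for [G]-most [m],
    [P (n, m)] holds.  For a free [G] this contains the set of pairs [n < m], and
    differences [c n - c m] tend to 0 along it if [c] converges along [G]. *)
Definition iterated (G : set_system nat) : set_system (nat * nat) :=
  [set P | G [set n | G [set m | P (n, m)]]].

Lemma iterated_proper G : ProperFilter G -> ProperFilter (iterated G).
Proof.
move=> GP; apply: Build_ProperFilter_ex.
  move=> P GP'; have [n Gn] := @filter_ex _ G _ _ GP'.
  by have [m Pnm] := filter_ex Gn; exists (n, m).
split.
- have GT : G setT by exact: filterT.
  exact: (@filterS _ G _ setT).
- move=> P Q GP' GQ; apply: (@filterS2 _ G _ _ _ _ _ GP' GQ) => n; exact: filterI.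
- by move=> P Q PQ; apply: (@filterS _ G) => n; apply: (@filterS _ G) => m; exact: PQ.
Qed.

(** [A] is the closure of a countable additive subgroup containing the rational
    multiples of the [x n].  Thus [A] is separable, and [a + s *: (x n - x m)]
    remains in [A] for [a] in [A] and [s] rational. *)
Lemma not_decomposable (R : realType) (X : completeNormedModType R) :
  contains_isomorphic_copy X (ell1 R) ->
  exists2 A : set X, separable_set A & forall A_ : nat -> set X,
    (forall n, relatively_weakly_closed A (A_ n)) -> A = \bigcup_n A_ n ->
    ~ forall n, weakly_Frechet_Urysohn (A_ n).
Proof.
move=> /copy_separated_sequence[x [M xM] xS].
pose h (s : seq (rat * nat)) : X := \sum_(p <- s) ratr p.1 *: x p.2.
exists (closure (range h)).
  apply/separable_setP; exists (range h) => //.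
  exact: (sub_countable (card_image_le _ _)).
set A := closure _.
have hD s s' : h (s ++ s') = h s + h s' by rewrite /h big_cat.
have AD a s : A a -> A (a + h s).
  move=> Aa W /nbhs_ballP[e /= e0 eW].
  have [_ [[s' _ <-]]] := Aa _ (nbhsx_ballx a e e0).
  rewrite -ball_normE /= => as'.
  exists (h (s ++ s')); split; first by exists (s ++ s').
  by apply: eW; rewrite -ball_normE /= hD addrKA.
move=> A_ cA_ AA_ FU.
have [|| |n y Ay nAy|N [a [r [Aa r0 ball_sub]]]] := @baire_closed R X A A_.
- exact: closed_closure.
- by exists (h [::]); apply: subset_closure; exists [::].
- by rewrite -AA_.
- have [_] := cA_ n; rewrite -openC openE => /(_ (exist _ y (mem_set Ay)) nAy).
  move=> [_ [[V oV <-] Vy] VF].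
  have /nbhs_ballP[r /= r0 rV] : nbhs y V.
    by apply: weak_nbhs; exact: open_nbhs_nbhs.
  exists r => // z Az zr; apply: (VF (exist _ z (mem_set Az))).
  by apply: rV; rewrite -ball_normE /= distrC.
have M1 : 0 < M + 1 by rewrite ltr_wpDl// (le_trans _ (xM 0)).
have [k kr] := ex_invS_lt (divr_gt0 r0 (addr_gt0 M1 M1)).
(* A rational factor that brings all the points [y p] into the ball. *)
pose s : R := k.+1%:R^-1.
have s0 : 0 < s by rewrite invr_gt0.
pose y (p : nat * nat) := a + s *: (x p.1 - x p.2).
have yA p : A_ N (y p).
  apply: ball_sub.
    have -> : y p = a + h [:: (k.+1%:R^-1, p.1); (- k.+1%:R^-1, p.2)].
      rewrite /y /h !big_cons big_nil/= addr0 scalerBr -scaleNr.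
      by congr (_ + (_ *: _ + _ *: _)); rewrite ?rmorphN fmorphV rmorph_nat.
    exact: AD.
  rewrite addrC addKr normrZ gtr0_norm//.
  have : `|x p.1 - x p.2| <= (M + 1) + (M + 1).
    apply: le_trans (ler_normB _ _) _.
    by apply: lerD; apply: le_trans (xM _) _; rewrite lerDl.
  move=> xp; apply: le_lt_trans (ler_wpM2l (ltW s0) xp) _.
  by rewrite -ltr_pdivlMr// addr_gt0.
have aN : A_ N a by apply: ball_sub; rewrite // subrr normr0.
pose S_N := @set_type (weak X) (A_ N).
pose Y p : S_N := exist _ (y p) (mem_set (yA p)).
pose a' : S_N := exist _ a (mem_set aN).
have [G [GU Ginfty]] := ultraFilterLemma (@eventually_filter).
have GP := iterated_proper (@ultra_proper _ _ GU).
have Ya : Y @ iterated G --> a'.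
  apply: cvg_set_type; apply: cvg_weak => f fK.
  have [l fl] : exists l : R, (f \o x) @ G --> l.
    apply: (@ultra_bounded_cvg R G (f \o x) M GU) => n.
    exact: le_trans (dual_ball_norm _ fK) (xM n).
  apply/cvgrPdist_lt => e e0.
  have e20 : 0 < e / (s * 2) by rewrite divr_gt0// mulr_gt0.
  have /cvgrPdist_lt/(_ _ e20) fle := fl.
  suff : iterated G [set p | `|f a - f (y p)| < e] by [].
  rewrite /iterated /=; apply: (@filterS _ G _ _ _ _ fle) => n /= ln.
  apply: (@filterS _ G _ _ _ _ fle) => m /= lm.
  rewrite /y linearD linearZ linearB /= opprD addrA subrr sub0r normrN.
  rewrite normrM gtr0_norm// -ltr_pdivlMl//.
  rewrite -(subrKA l); apply: le_lt_trans (ler_normD _ _) _.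
  rewrite -[f (x n) - l]opprB normrN.
  have -> : s^-1 * e = e / (s * 2) + e / (s * 2) by field; rewrite gt_eqF.
  exact: ltrD.
pose B := Y @` [set p | (p.1 < p.2)%N].
have aB : closure B a'.
  rewrite closureEcvg; exists (Y @ iterated G); first exact: fmap_proper_filter.
  split=> // P BP; apply: nearW => n /=; apply: Ginfty.
  by exists n.+1 => // m /= nm; apply: BP; exists (n, m).
have [u uB ua] := FU N B a' aB.
have /choice[p pP] : forall k, exists p : nat * nat, (p.1 < p.2)%N /\ Y p = u k.
  by move=> j; have [p plt pu] := uB j; exists p.
have [S SP] := @separating_pairs (fst \o p) (snd \o p) (fun j => (pP j).1).
have [F cF Fx] := xS S.
have : F (set_val (u j)) @[j --> \oo] --> F a.
  have c1 : (set_val \o u : nat -> weak X) @ \oo --> (a : weak X).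
    exact: (cvg_comp _ _ ua (@set_val_continuous (weak X) (A_ N) a')).
  exact: (cvg_comp _ _ c1 (@weak_continuous R X F cF a)).
move=> /cvgrPdist_lt/(_ _ s0)[K _ FK].
have [j Kj] := SP K; have := FK j Kj.
rewrite /= -(pP j).2 set_valE /= /y linearD linearZ linearB /= !Fx.
rewrite opprD addrA subrr sub0r normrN normrM gtr0_norm// gtr_pMr//.
by case: (S _) => /=; case: (S _) => //=; rewrite ?subr0 ?sub0r ?normrN normr1 ltxx.
Qed.

Theorem theorem2p4 (R : realType) (X : completeNormedModType R) :
  [<-> ~ contains_isomorphic_copy X (ell1 R);
       forall A : set X, bounded_set A -> separable_set A ->
         weakly_Frechet_Urysohn A;
       forall A : set X, separable_set A ->
         exists A_ : nat -> set X,
           [/\ forall n, relatively_weakly_closed A (A_ n),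
               A = \bigcup_n A_ n &
               forall n, weakly_Frechet_Urysohn (A_ n)]].
Proof.
tfae.
- by move=> nol1 A bA _; exact: frechet_urysohn_bounded.
- exact: bounded_implies_decomposition.
- move=> decA /not_decomposable[A sA nA].
  by have [A_ [cA AA FUA]] := decA A sA; exact: (nA A_ cA AA FUA).
Qed.
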